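(* Let $p$ be a prime number and $n\geqslant 1$. For any integers $0\leqslant s<n$ and $i\geqslant 1$, the action of the primitive Milnor operation $St^{\Delta_i}$ on the Dickson invariant $Q_{n,s}$ is given by $$St^{\Delta_i}(Q_{n,s}) = (-1)^n Q_{n,0}\big(P_{n,i,s}^{\,p} + R_{n,i}^{\,p}\,Q_{n,s}\big),$$ where $P_{n,i,0}=0$, $P_{n,i,s} = -[0,\ldots,\widehat{s-1},\ldots,n-1,i-1]/L_n$ for $s>0$, and $R_{n,i}=[0,1,\ldots,n-2,i-1]/L_n$.
   Context: Let $\mathbb F_p$ be the prime field of $p$ elements and $P_n=\mathbb F_p[x_1,\ldots,x_n]$, graded by $\dim x_j=1$ if $p=2$ and $\dim x_j=2$ if $p>2$. The mod $p$ Steenrod algebra $\mathcal A(p)$ acts on $P_n$ by the Cartan formula together with $\beta(x_j)=0$, $P^0(x_j)=x_j$, $P^1(x_j)=x_j^p$ and $P^k(x_j)=0$ for $k>1$ (for $p=2$, $P^k$ means $Sq^k$; for $p>2$, $\beta$ is the Bockstein operation). For a finite sequence $R$ of non-negative integers, $St^R\in\mathcal A(p)$ denotes the Milnor operation of type $R$ (with $St^{(k)}=P^k$), and for $i\geqslant 1$, $St^{\Delta_i}$ is the primitive Milnor operation, where $\Delta_i=(0,\ldots,0,1)$ has length $i$. Concretely, $St^{\Delta_i}$ acts on $P_n$ as the $\mathbb F_p$-linear derivation with $St^{\Delta_i}(x_j)=x_j^{p^i}$ for $1\leqslant j\leqslant n$. For a sequence $(e_1,\ldots,e_n)$ of non-negative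 integers, $[e_1,e_2,\ldots,e_n]\in P_n$ denotes the determinant of the $n\times n$ matrix whose $(k,j)$ entry is $x_j^{p^{e_k}}$. A hat over an entry means that this entry is omitted; e.g. $[0,\ldots,\widehat{s-1},\ldots,n-1,i-1]$ is obtained from the list $0,1,\ldots,n-1$ by deleting $s-1$ and then appending $i-1$ at the end. Set $L_{n,s}=[0,1,\ldots,\hat s,\ldots,n]$ for $0\leqslant s\leqslant n$ and $L_n=L_{n,n}=[0,1,\ldots,n-1]$. Every $[e_1,\ldots,e_n]$ is divisible by $L_n$ in $P_n$. The Dickson invariants are $Q_{n,s}=L_{n,s}/L_n$ for $0\leqslant s<n$; in particular $Q_{n,0}=L_n^{p-1}$. *)

(* Defs.v *)
From HB Require Import structures.
From mathcomp Require Import all_boot all_order all_algebra.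
From mathcomp Require Import mpoly.
From Stdlib Require Import ClassicalEpsilon.

Set Implicit Arguments.
Unset Strict Implicit.
Unset Printing Implicit Defensive.

Import GRing.Theory.

Local Open Scope ring_scope.

(* The action on P_n = F_p[x_1, ..., x_n] of the primitive Milnor operation
   St^{Delta_i}: the F_p-linear derivation sending each x_j to x_j^(p^i).
   The lemmas below check that the formula is this derivation and the only
   one. The variables are indexed from 0: the x_j of the text is 'X_(j-1). *)
Definition St_Delta (p n i : nat) (f : {mpoly 'F_p[n]}) : {mpoly 'F_p[n]} :=
  \sum_(j < n) 'X_j ^+ (p ^ i) * f^`M(j).

Lemma St_Delta_is_linear (p n i : nat) : linear (@St_Delta p n i).
Proof.
move=> a f g; rewrite /St_Delta scaler_sumr -big_split /=.
by apply: eq_bigr => j _; rewrite mderivD mderivZ mulrDr scalerAr.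
Qed.

Lemma St_DeltaM (p n i : nat) (f g : {mpoly 'F_p[n]}) :
  St_Delta i (f * g) = St_Delta i f * g + f * St_Delta i g.
Proof.
rewrite /St_Delta mulr_suml mulr_sumr -big_split /=.
by apply: eq_bigr => j _; rewrite mderivM mulrDr !mulrA (mulrC f).
Qed.

Lemma St_DeltaX (p n i : nat) (j : 'I_n) :
  St_Delta i ('X_j : {mpoly 'F_p[n]}) = 'X_j ^+ (p ^ i).
Proof.
have zero k : k != j -> 'X_k ^+ (p ^ i) * ('X_j : {mpoly 'F_p[n]})^`M(k) = 0.
  by move=> kj; rewrite mderivX mnm1E eq_sym (negPf kj) scale0r mulr0.
rewrite /St_Delta (bigD1 j) //= big1 ?addr0
  ?mderivX ?mnm1E ?eqxx ?scale1r //.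
suff -> : (U_(j) - U_(j))%MM = 0%MM by rewrite mpolyX0 mulr1.
by apply/mnmP => k; rewrite mnmBE mnm0E subnn.
Qed.

Lemma St_Delta_unique (p n i : nat) (D : {mpoly 'F_p[n]} -> {mpoly 'F_p[n]}) :
    linear D -> (forall f g, D (f * g) = D f * g + f * D g) ->
    (forall j : 'I_n, D 'X_j = 'X_j ^+ (p ^ i)) ->
  D =1 St_Delta i.
Proof.
move=> Dlin DM DX.
have D0 : D 0 = 0.
  by have := Dlin (-1) 0 0; rewrite scaler0 addr0 scaleN1r addNr.
have S0 : St_Delta i 0 = 0 :> {mpoly 'F_p[n]}.
  by rewrite -[RHS](addNr (St_Delta i 0)) -scaleN1r -St_Delta_is_linear
             scaler0 addr0.
have der1 E : (forall f g : {mpoly 'F_p[n]}, E (f * g) = E f * g + f * E g) ->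
    E 1 = 0.
  move=> /(_ 1 1); rewrite !mulr1 mul1r => E1.
  by apply: (@addrI _ (E 1)); rewrite addr0 -E1.
have eqM f g : D f = St_Delta i f -> D g = St_Delta i g ->
    D (f * g) = St_Delta i (f * g).
  by move=> Ef Eg; rewrite DM St_DeltaM Ef Eg.
have eq1 : D 1 = St_Delta i 1.
  by rewrite (der1 D DM) (der1 (@St_Delta p n i) (@St_DeltaM p n i)).
elim/mpolyind => [|c m f _ _ IHf]; first by rewrite D0 S0.
rewrite Dlin St_Delta_is_linear IHf; congr (_ *: _ + _).
rewrite mpolyXE_id.
apply: (big_ind (fun f => D f = St_Delta i f)) => // j _.
elim: (m j) => [|k IHk]; first by rewrite expr0.
by rewrite exprS; apply: eqM => //; rewrite DX St_DeltaX.
Qed.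

(* [e_1, ..., e_n], used only for lists e of length n. *)
Definition bracket (p n : nat) (e : seq nat) : {mpoly 'F_p[n]} :=
  \det (\matrix_(k < n, j < n) 'X_j ^+ (p ^ nth 0%N e k)).

(* a / b in P_n: the q with q * b = a, unique when b != 0; arbitrary if b does
   not divide a. (The ring operation a / b of {mpoly _} is not this quotient
   when b is not a unit.) *)
Definition mquot (p n : nat) (a b : {mpoly 'F_p[n]}) : {mpoly 'F_p[n]} :=
  epsilon (inhabits 0) (fun q => q * b = a).

Lemma mquotK (p n : nat) (a b : {mpoly 'F_p[n]}) :
  (exists q, q * b = a) -> mquot a b * b = a.
Proof. exact: epsilon_spec. Qed.

Lemma mulmquot (p n : nat) (q b : {mpoly 'F_p[n]}) :
  b != 0 -> mquot (q * b) b = q.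
Proof.
by move=> nz_b; apply: (mulIf nz_b); apply: mquotK; exists q.
Qed.

(* rem s (iota 0 m) is the list 0, ..., m-1 with s omitted. *)
Definition Lns (p n s : nat) : {mpoly 'F_p[n]} :=
  bracket p n (rem s (iota 0 n.+1)).

Definition Ln (p n : nat) : {mpoly 'F_p[n]} := Lns p n n.

Definition dickson (p n s : nat) : {mpoly 'F_p[n]} := mquot (Lns p n s) (Ln p n).

(* Meaningful for i >= 1, so that i.-1 is i - 1. *)
Definition Pnis (p n i s : nat) : {mpoly 'F_p[n]} :=
  if s is s'.+1
  then - mquot (bracket p n (rcons (rem s' (iota 0 n)) i.-1)) (Ln p n)
  else 0.

(* Meaningful for n, i >= 1. *)
Definition Rni (p n i : nat) : {mpoly 'F_p[n]} :=
  mquot (bracket p n (rcons (iota 0 n.-1) i.-1)) (Ln p n).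

(* Main.v *)
(* A derivation kills p-th powers, so D = St^Delta_i sees only the row of
   exponent 0 in a bracket: D[0, e_2 + 1, ..., e_n + 1] is
   [i, e_2 + 1, ..., e_n + 1] = [i - 1, e_2, ..., e_n]^p. Applying D to
   Q_{n,s} L_n = L_{n,s} then expresses D(Q_{n,s}) L_n by p-th powers of
   brackets, from which L_n^p = Q_{n,0} L_n factors out. *)
Require Import Defs.
From HB Require Import structures.
From mathcomp Require Import all_boot all_order all_fingroup all_algebra.
From mathcomp Require Import mpoly ring.

Import GRing.Theory.
Local Open Scope ring_scope.

Lemma map_rem {T1 T2 : eqType} (f : T1 -> T2) (f_inj : injective f)
    (x : T1) (xs : seq T1) :
  map f (rem x xs) = rem (f x) (map f xs).
Proof.
elim: xs => //= y xs IHxs; rewrite (inj_eq f_inj).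
by case: (y == x); rewrite //= IHxs.
Qed.

(* The roots y of V(y) = y^(p^m) - \sum_(k < m) c_k y^(p^k) and an extra x are
   roots of V(y)^p - V(x)^(p-1) V(y), which has the same shape. *)
Lemma common_root_ppoly {R : comNzRingType} {p : nat} (charRp : p \in [pchar R])
    (xs : seq R) :
  exists c : nat -> R, {in xs, forall y,
    y ^+ (p ^ size xs) = \sum_(k < size xs) c k * y ^+ (p ^ k)}.
Proof.
elim: xs => [|x xs [c cP]] /=; first by exists (fun=> 0).
set m := size xs in cP *.
pose V y := y ^+ (p ^ m) - \sum_(k < m) c k * y ^+ (p ^ k).
pose a := V x ^+ p.-1.
(* Expanding [V y ^+ p - a * V y]: Frobenius moves [c k] to [c k ^+ p] at index [k.+1], and
   [a * V y] contributes [a] at index [m] and [- a * c k] below it. *)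
exists (fun k => (if k is k'.+1 then c k' ^+ p else 0)
                 + a * (if k == m then 1 else - c k)).
move=> y y_in.
have VpE : V y ^+ p = y ^+ (p ^ m.+1) - \sum_(k < m) c k ^+ p * y ^+ (p ^ k.+1).
  rewrite -[LHS](pFrobenius_autE charRp) rmorphB rmorph_sum /=.
  rewrite pFrobenius_autE -exprM -expnSr; congr (_ - _).
  apply: eq_bigr => k _.
  by rewrite rmorphM /= !pFrobenius_autE -exprM -expnSr.
have aVE : V y ^+ p = a * V y.
  case: (boolP (y \in xs)) => [/cP yE|y_out].
    rewrite /V yE subrr mulr0 expr0n.
    by have /negPf -> : p != 0%N by rewrite -lt0n prime_gt0 ?(pcharf_prime charRp).
  have -> : y = x by move: y_in; rewrite inE (negPf y_out) orbF => /eqP.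
  by rewrite /a -exprSr prednK // prime_gt0 // (pcharf_prime charRp).
under eq_bigr do rewrite mulrDl -mulrA.
rewrite big_split /= big_ord_recl /= mul0r add0r -mulr_sumr big_ord_recr /=.
rewrite eqxx mul1r.
under [X in a * (X + _)]eq_bigr => k _ do rewrite (ltn_eqF (ltn_ord k)) mulNr.
by rewrite sumrN [X in a * X]addrC -/(V y) -aVE VpE addrC subrK.
Qed.

(** Reduction modulo the monic p-polynomial of [common_root_ppoly], by induction on [e]. The
    coefficients are common to all [y] in [xs], which is what makes a matrix factorization possible
    later. *)
Lemma pow_in_low_pows {R : comNzRingType} {p : nat} (charRp : p \in [pchar R])
    (xs : seq R) (e : nat) :
  exists c : nat -> R, {in xs, forall y,
    y ^+ (p ^ e) = \sum_(k < size xs) c k * y ^+ (p ^ k)}.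
Proof.
have [d dP] := common_root_ppoly charRp xs.
elim: e => [|e [c cP]].
  case: xs d dP => [|x xs] d dP; first by exists (fun=> 0).
  exists (fun k => (k == 0%N)%:R) => y _ /=.
  by rewrite big_ord_recl /= mul1r big1 ?addr0 // => k _; rewrite mul0r.
case: (posnP (size xs)) => [/size0nil ->|m_gt0]; first by exists (fun=> 0).
set m := size xs in dP cP m_gt0 *.
(* Raising the relation for [e] to the power [p] shifts every index by one; the overflowing top term
   [c m.-1 ^+ p * y ^+ (p ^ m)] is rewritten with [d]. *)
exists (fun k => (if k is k'.+1 then c k' ^+ p else 0) + c m.-1 ^+ p * d k).
move=> y y_in.
rewrite expnSr exprM -[LHS](pFrobenius_autE charRp) (cP y y_in) rmorph_sum /=.
under eq_bigr do rewrite rmorphM /= !pFrobenius_autE -exprM -expnSr.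
under [RHS]eq_bigr do rewrite mulrDl -mulrA.
rewrite big_split /= -mulr_sumr -(dP y y_in).
by case: (m) m_gt0 => // m' _; rewrite big_ord_recr big_ord_recl /= mul0r add0r.
Qed.

Section Derivation.

Variables (p n : nat).
Hypothesis p_prime : prime p.
Implicit Types (f g q : {mpoly 'F_p[n]}) (e t : seq nat).

Let charp : p \in [pchar {mpoly 'F_p[n]}].
Proof. by rewrite pchar_lalg pchar_Fp. Qed.

Lemma LnE : Ln p n = bracket p n (iota 0 n).
Proof.
rewrite /Ln /Lns; congr (bracket p n _).
by rewrite -addn1 iotaD add0n /= cats1 rem_filter ?rcons_uniq ?mem_iota
  ?iota_uniq ?ltnn ?andbF // filter_rcons /= eqxx /=;
  apply/all_filterP/allP => k; rewrite mem_iota /= => /ltn_eqF ->.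
Qed.

(** Each row of the matrix of [bracket p n e] is a combination of the rows of the matrix of
    [Ln p n], so the quotient is the determinant of the coefficients. *)
Lemma dvd_Ln_bracket e : exists q, q * Ln p n = bracket p n e.
Proof.
pose xs : seq {mpoly 'F_p[n]} := codom (fun j : 'I_n => 'X_j).
have xsE : size xs = n by rewrite size_codom card_ord.
have /fin_all_exists [c cP] (k : 'I_n) : exists c : nat -> {mpoly 'F_p[n]},
    forall j : 'I_n, 'X_j ^+ (p ^ nth 0%N e k)
      = \sum_(l < n) c l * 'X_j ^+ (p ^ l).
  have [c cP] := pow_in_low_pows charp xs (nth 0%N e k).
  by exists c => j; rewrite cP ?codom_f // xsE.
exists (\det (\matrix_(k, l) c k l)).
rewrite LnE -det_mulmx; congr (\det _); apply/matrixP => k j; rewrite !mxE cP.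
by apply: eq_bigr => l _; rewrite !mxE nth_iota.
Qed.

Lemma mquot_bracketK e : mquot (bracket p n e) (Ln p n) * Ln p n = bracket p n e.
Proof. exact: mquotK (dvd_Ln_bracket e). Qed.

(* Distinct terms of the Leibniz expansion are distinct monomials. *)
Lemma Ln_neq0 : Ln p n != 0.
Proof.
(* In the term of [s], column [j] is met by row [s^-1 j], whence its exponent. *)
pose mon (s : 'S_n) := [multinom (p ^ (s^-1)%g j)%N | j < n].
have XE (s : 'S_n) :
    \prod_(k < n) 'X_(s k) ^+ (p ^ k) = 'X_[mon s] :> {mpoly 'F_p[n]}.
  rewrite (mpolyXE _ s); apply: eq_bigr => k _.
  by rewrite mnmE permK.
have mon_inj : injective mon.
  move=> s u /mnmP su; apply: invg_inj; apply/permP => j; apply: val_inj.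
  by apply: (expnI (prime_gt1 p_prime)); have := su j; rewrite !mnmE.
suff: (Ln p n)@_(mon 1%g) = 1.
  by apply: contra_eq_neq => ->; rewrite mcoeff0 eq_sym oner_neq0.
rewrite LnE /bracket /determinant raddf_sum (bigD1 1%g) //=.
rewrite [X in _ + X]big1 => [|s s_neq1].
  rewrite addr0 odd_perm1 mul1r.
  under eq_bigr do rewrite mxE nth_iota //.
  by rewrite XE mcoeffX eqxx.
under eq_bigr do rewrite mxE nth_iota //.
rewrite XE mulr_sign; case: (odd_perm s); rewrite ?mcoeffN mcoeffX;
  by rewrite (inj_eq mon_inj) (negPf s_neq1) ?oppr0.
Qed.

Lemma St_Delta_sum i (I : finType) (F : I -> {mpoly 'F_p[n]}) :
  St_Delta i (\sum_k F k) = \sum_k St_Delta i (F k).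
Proof.
pose L := GRing.isLinear.Build _ _ _ _ _ (@St_Delta_is_linear p n i).
pose D : {linear _ -> _} := HB.pack (@St_Delta p n i) L.
exact: (raddf_sum D).
Qed.

Lemma St_Delta_pow i f : St_Delta i (f ^+ p) = 0.
Proof.
have DX k : St_Delta i (f ^+ k.+1) = St_Delta i f * f ^+ k *+ k.+1.
  elim: k => [|k IHk]; first by rewrite expr0 mulr1.
  rewrite exprS St_DeltaM IHk mulrnAr mulrCA -exprS.
  by rewrite [RHS]mulrS.
by have := DX p.-1; rewrite prednK ?prime_gt0 // mulrn_pchar.
Qed.

Lemma bracket_mapS t : size t = n -> bracket p n (map S t) = bracket p n t ^+ p.
Proof.
move=> tn; rewrite -[RHS](pFrobenius_autE charp) -det_map_mx; congr (\det _).
apply/matrixP => k j; rewrite !mxE (nth_map 0%N) ?tn //=.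
by rewrite pFrobenius_autE -exprM -expnSr.
Qed.

End Derivation.

(** Laplace expansion along the last row and along the first gives the same minors, with signs
    differing by [(-1) ^+ n]. *)
Lemma bracket_rcons (p n e : nat) (t : seq nat) : size t = n ->
  bracket p n.+1 (rcons t e) = (-1) ^+ n * bracket p n.+1 (e :: t).
Proof.
move=> tn; rewrite /bracket (expand_det_row _ ord_max) (expand_det_row _ ord0).
rewrite mulr_sumr; apply: eq_bigr => j _; rewrite !mxE /= nth_rcons tn ltnn eqxx.
rewrite [RHS]mulrCA; congr (_ * _); rewrite /cofactor add0n exprD -mulrA.
congr (_ * (_ * \det _)).
apply/matrixP => k l; rewrite !mxE /= /bump leqNgt ltn_ord.
by rewrite nth_rcons tn ltn_ord.
Qed.

Lemma St_Delta_bracket (p n i : nat) (t : seq nat) : prime p -> size t = n ->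
  St_Delta i (bracket p n.+1 (0%N :: map S t)) = bracket p n.+1 (i :: map S t).
Proof.
move=> p_prime tn; rewrite /bracket !(expand_det_row _ ord0) St_Delta_sum.
have charp : p \in [pchar {mpoly 'F_p[n.+1]}] by rewrite pchar_lalg pchar_Fp.
apply: eq_bigr => j _; rewrite !mxE /= St_DeltaM St_DeltaX.
set C0 := cofactor _ _ _; set C1 := cofactor _ _ _.
pose N : 'M[{mpoly 'F_p[n.+1]}]_n.+1 :=
  \matrix_(k, j) 'X_j ^+ (p ^ nth 0%N (0%N :: t) k).
(* The cofactor deletes row 0, the only one that depends on [e]; the other rows are Frobenius images
   of those of [N]. The cofactor is thus a p-th power, a constant for the derivation. *)
have cofE e : cofactor (\matrix_(k < n.+1, j < n.+1)
    'X_j ^+ (p ^ nth 0%N (e :: map S t) k)) ord0 j = cofactor N ord0 j ^+ p.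
  rewrite -[RHS](pFrobenius_autE charp) -cofactor_map_mx.
  congr (_ * \det _); apply/matrixP => k l; rewrite !mxE /=.
  rewrite (nth_map 0%N) ?tn ?ltn_ord // add0n.
  by rewrite pFrobenius_autE -exprM -expnSr.
by rewrite /C0 /C1 !cofE St_Delta_pow // mulr0 addr0.
Qed.

Theorem theorem2p2 (p n s i : nat) (p_prime : prime p) (n_ge1 : (1 <= n)%N)
    (s_lt_n : (s < n)%N) (i_ge1 : (1 <= i)%N) :
  St_Delta i (dickson p n s) =
    (-1) ^+ n * dickson p n 0 *
      (Pnis p n i s ^+ p + Rni p n i ^+ p * dickson p n s).
Proof.
case: n n_ge1 s_lt_n => // m _ s_le_m; case: i i_ge1 => // i _.
have charp : p \in [pchar {mpoly 'F_p[m.+1]}] by rewrite pchar_lalg pchar_Fp.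
set n := m.+1; set L := Ln p n; set Q := dickson p n s.
have QL u : dickson p n u * L = Lns p n u by apply: mquot_bracketK.
have iotaS k : iota 1 k = map S (iota 0 k) by rewrite (iotaDl 1 0).
(* [Lns p n 0] is [[1, ..., n]], the Frobenius image of [[0, ..., n-1]]. *)
have Q0L : dickson p n 0 * L = L ^+ p.
  by rewrite QL /L LnE -(bracket_mapS _ _ p_prime) ?size_iota -?iotaS.
have sgnP : ((-1) ^+ m : {mpoly 'F_p[n]}) ^+ p = (-1) ^+ m.
  by rewrite -(pFrobenius_autE charp) rmorph_sign.
(* From here [i] stands for the [i - 1] of the statement, and [m] for [n - 1]. The sign comes from
   moving [i] past the [m] entries of [t]. *)
have DbrE t : size t = m -> St_Delta i.+1 (bracket p n (0%N :: map S t))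
    = (-1) ^+ m * bracket p n (rcons t i) ^+ p.
  move=> tm; rewrite St_Delta_bracket // -[_ :: _]/(map S (i :: t)).
  rewrite (bracket_mapS _ _ p_prime (i :: t) (congr1 S tm)).
  rewrite (bracket_rcons _ _ _ _ tm) exprMn sgnP.
  by move: (_ ^+ p) => b; rewrite signrMK.
have DL : St_Delta i.+1 L = (-1) ^+ m * (Rni p n i.+1 ^+ p * L ^+ p).
  have RL : Rni p n i.+1 * L = bracket p n (rcons (iota 0 m) i).
    exact: mquot_bracketK.
  by rewrite -exprMn RL -(DbrE _ (size_iota 0 m)) -iotaS /L LnE.
have DLs : St_Delta i.+1 (Lns p n s)
    = - ((-1) ^+ m * (Pnis p n i.+1 s ^+ p * L ^+ p)).
  case: (s) s_le_m => [|s'] s'_lt_m.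
    (* For [s = 0] the bracket is itself a p-th power, so its derivative vanishes, in accordance
       with [Pnis] being 0. *)
    rewrite -QL Q0L (St_Delta_pow _ _ p_prime) expr0n.
    by rewrite (gtn_eqF (prime_gt0 p_prime)) mul0r mulr0 oppr0.
  have PL : Pnis p n i.+1 s'.+1 * L
      = - bracket p n (rcons (rem s' (iota 0 m.+1)) i).
    by rewrite mulNr; congr (- _); apply: mquot_bracketK.
  rewrite -exprMn PL -(pFrobenius_autE charp) pFrobenius_autN mulrN opprK.
  rewrite pFrobenius_autE -DbrE; last first.
    by rewrite size_rem ?size_iota // mem_iota (ltnW s'_lt_m).
  (* Deleting [s'.+1] from [0, ..., n] leaves 0 followed by the shift of [0, ..., m] without
     [s']. *)
  by rewrite (map_rem _ succn_inj) -iotaS.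
have L_neq0 : L != 0 by apply: Ln_neq0.
have QsL : Q * L = Lns p n s by apply: QL.
move: Q0L DL DLs; rewrite -QsL exprS.
move: (dickson p n 0) (Pnis p n i.+1 s ^+ p) (Rni p n i.+1 ^+ p) => Q0 P R.
clear QL QsL; clearbody Q L => Q0L DL; rewrite St_DeltaM DL -Q0L => DQL.
(* The term added to both sides is [Q] times the derivative of [L], which completes the Leibniz rule
   for [Q * L]; the outer sign is [(-1) ^+ n = - (-1) ^+ m]. *)
apply: (mulIf L_neq0); apply: (addIr (Q * ((-1) ^+ m * (R * (Q0 * L))))).
by rewrite DQL; ring.
Qed.
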